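(* Let $k<d$, let $M_1,\dots,M_k\in\mathbb{R}^{d\times d}$ be symmetric positive semidefinite matrices, let $\bar U\in \mathrm{St}(k,d)$, and let $$\bar\Lambda=\mathrm{sym}\Big(\sum_{i=1}^k \bar U' M_i\bar U E_i\Big),$$ where $E_i=e_ie_i'$ and $e_i$ is the $i$-th standard basis vector of $\mathbb{R}^k$. Suppose there exists $\bar\nu=(\bar\nu_1,\dots,\bar\nu_k)\in\mathbb{R}^k$ such that, with $D_{\bar\nu}:=\mathrm{diag}(\bar\nu_1,\dots,\bar\nu_k)$, $$\bar U(\bar\Lambda-D_{\bar\nu})\bar U'+\bar\nu_i I_d-M_i\succeq 0\quad\text{for all } i=1,\dots,k,\qquad\text{and}\qquad \bar\Lambda-D_{\bar\nu}\succeq 0 .$$ Then $\bar U$ is a globally optimal solution of the nonconvex problem $$\max_{U=[u_1\cdots u_k]\in\mathrm{St}(k,d)}\ \sum_{i=1}^k u_i'M_iu_i .$$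
   Context: $A'$ denotes the transpose of $A$. $\mathrm{St}(k,d)=\{U\in\mathbb{R}^{d\times k}:U'U=I_k\}$ is the Stiefel manifold. $\mathrm{sym}(A):=\tfrac12(A+A')$. $\succeq$ denotes the positive semidefinite (Loewner) order on symmetric matrices. *)

(* Defs.v *)
From mathcomp Require Import all_boot all_order all_algebra.
From mathcomp Require Import classical_sets reals.

Set Implicit Arguments.
Unset Strict Implicit.
Unset Printing Implicit Defensive.

Import Order.TTheory GRing.Theory Num.Theory.

Local Open Scope classical_set_scope.
Local Open Scope ring_scope.

(* Symmetry is required explicitly: over the reals a nonnegative quadratic form
   does not force it. *)
Definition psdmx (R : realType) (n : nat) (A : 'M[R]_n) : Prop :=
  A \is symmetricmx /\ forall x : 'cV[R]_n, 0 <= (x^T *m A *m x) 0 0.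

Definition loewner_le (R : realType) (n : nat) (A B : 'M[R]_n) : Prop :=
  psdmx (B - A).

Definition stiefel (R : realType) (k d : nat) : set 'M[R]_(d, k) :=
  [set U | U^T *m U = 1%:M].
Arguments stiefel : clear implicits.

Definition symmx (R : realType) (n : nat) (A : 'M[R]_n) : 'M[R]_n :=
  2^-1 *: (A + A^T).

Definition std_basis (R : realType) (k : nat) (i : 'I_k) : 'cV[R]_k :=
  delta_mx i 0.

Definition basis_proj (R : realType) (k : nat) (i : 'I_k) : 'M[R]_k :=
  std_basis R i *m (std_basis R i)^T.

Definition lagrange_mult (R : realType) (k d : nat) (M : 'I_k -> 'M[R]_d)
    (U : 'M[R]_(d, k)) : 'M[R]_k :=
  symmx (\sum_(i < k) U^T *m M i *m U *m basis_proj R i).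

Definition objective (R : realType) (k d : nat) (M : 'I_k -> 'M[R]_d)
    (U : 'M[R]_(d, k)) : R :=
  \sum_(i < k) ((col i U)^T *m M i *m col i U) 0 0.

Definition global_maximizer (R : realType) (T : Type) (S : set T) (f : T -> R)
    (x : T) : Prop :=
  S x /\ forall y, S y -> f y <= f x.

(* Main.v *)
Require Import Defs.
From mathcomp Require Import all_boot all_order all_algebra.
From mathcomp Require Import classical_sets reals.

(** With [P = Lbar - diag nu], each [M i] is dominated by
    [Ubar P Ubar' + nu_i I], so on the Stiefel manifold the objective at [U] is
    at most [tr (U' Ubar P Ubar' U) + tr (diag nu)]. Since [I - U U'] is an
    orthogonal projection and [P] is positive semidefinite, the first trace is
    at most [tr P]. The resulting bound [tr Lbar] is the objective at [Ubar]. *)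

Import Order.TTheory GRing.Theory Num.Theory.

Local Open Scope ring_scope.

Lemma quad_col (R : realType) (m n : nat) (A : 'M[R]_m) (U : 'M[R]_(m, n))
    (i : 'I_n) :
  ((col i U)^T *m A *m col i U) 0 0 = (U^T *m A *m U) i i.
Proof. by rewrite tr_col -row_mul colE mulmxA -row_mul -colE !mxE. Qed.

Lemma psdmx_diag_ge0 (R : realType) (m n : nat) (A : 'M[R]_m)
    (U : 'M[R]_(m, n)) (i : 'I_n) :
  psdmx A -> 0 <= (U^T *m A *m U) i i.
Proof. by case=> _ A_ge0; rewrite -quad_col. Qed.

Lemma psdmx_trace_ge0 (R : realType) (m n : nat) (A : 'M[R]_m)
    (U : 'M[R]_(m, n)) :
  psdmx A -> 0 <= \tr (U^T *m A *m U).
Proof. by move=> psdA; apply: sumr_ge0 => i _; apply: psdmx_diag_ge0. Qed.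

Lemma objective_diag (R : realType) (k d : nat) (M : 'I_k -> 'M[R]_d)
    (U : 'M[R]_(d, k)) :
  objective M U = \sum_(i < k) (U^T *m M i *m U) i i.
Proof. by apply: eq_bigr => i _; rewrite quad_col. Qed.

Lemma mxtrace_mul_basis_proj (R : realType) (k : nat) (A : 'M[R]_k)
    (i : 'I_k) :
  \tr (A *m basis_proj R i) = A i i.
Proof.
rewrite /basis_proj /std_basis mulmxA mxtrace_mulC -colE trmx_delta -rowE.
by rewrite trace_mx11 !mxE.
Qed.

Lemma mxtrace_symmx (R : realType) (n : nat) (A : 'M[R]_n) :
  \tr (symmx A) = \tr A.
Proof.
by rewrite mxtraceZ mxtraceD mxtrace_tr -mulr2n -[\tr A *+ 2]mulr_natl mulKf
   ?pnatr_eq0.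
Qed.

(** Symmetrizing preserves the trace, and each [basis_proj R i] keeps a single diagonal entry, which
    is the [i]-th term of the objective. *)
Lemma mxtrace_lagrange_mult (R : realType) (k d : nat) (M : 'I_k -> 'M[R]_d)
    (U : 'M[R]_(d, k)) :
  \tr (lagrange_mult M U) = objective M U.
Proof.
rewrite mxtrace_symmx raddf_sum objective_diag /=.
by apply: eq_bigr => i _; rewrite mxtrace_mul_basis_proj.
Qed.

(** With [Q = I - U U'], the gap between the two sides is the trace of [Q V P V' Q], a congruence of
    [P] and hence nonnegative. *)
Lemma stiefel_trace_le (R : realType) (k l d : nat) (P : 'M[R]_k)
    (V : 'M[R]_(d, k)) (U : 'M[R]_(d, l)) :
  psdmx P -> stiefel R k d V -> stiefel R l d U ->
  \tr (U^T *m (V *m P *m V^T) *m U) <= \tr P.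
Proof.
rewrite /stiefel /= => psdP VV UU.
pose Q : 'M[R]_d := 1%:M - U *m U^T.
have trQ : Q^T = Q by rewrite /Q linearB /= trmx1 trmx_mul trmxK.
have QQ : Q *m Q = Q.
  (* Only the left factor is unfolded: [U *m U^T *m Q] vanishes because [U^T *m U = 1%:M]. *)
  rewrite {1}/Q mulmxBl mul1mx [X in _ - X](_ : _ = 0) ?subr0 //.
  by rewrite /Q mulmxBr mulmx1 mulmxA -(mulmxA U) UU mulmx1 subrr.
have := psdmx_trace_ge0 _ _ _ _ (V^T *m Q) psdP.
rewrite trmx_mul trmxK trQ.
(* Cyclicity brings the two copies of [Q] together, and idempotence merges them. *)
have -> : \tr (Q *m V *m P *m (V^T *m Q)) = \tr (V *m P *m V^T *m Q).
  by rewrite -2!mulmxA mxtrace_mulC -!mulmxA QQ.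
rewrite {1}/Q mulmxBr mulmx1 linearB /= subr_ge0.
rewrite [X in _ <= X -> _]mxtrace_mulC (mulmxA V^T) VV mul1mx.
by rewrite (mulmxA _ U) mxtrace_mulC !mulmxA.
Qed.

Theorem theorem4p1 (R : realType) (k d : nat) (hkd : (k < d)%N)
    (M : 'I_k -> 'M[R]_d) (hM : forall i, psdmx (M i))
    (Ubar : 'M[R]_(d, k)) (hU : stiefel R k d Ubar)
    (Lbar : 'M[R]_k) (hL : Lbar = lagrange_mult M Ubar)
    (hnu : exists nu : 'rV[R]_k,
       (forall i : 'I_k,
          loewner_le 0
            (Ubar *m (Lbar - diag_mx nu) *m Ubar^T + (nu 0 i)%:M - M i)) /\
       loewner_le 0 (Lbar - diag_mx nu)) :
  global_maximizer (stiefel R k d) (objective M) Ubar.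
Proof.
split=> // U UU; case: hnu => nu [dom].
rewrite /loewner_le subr0; set P := Lbar - diag_mx nu in dom * => psdP.
(* The value at [Ubar] splits as [\tr P + \tr (diag_mx nu)]; the trace bound absorbs [\tr P] and
   leaves a comparison of diagonal entries. *)
rewrite -(mxtrace_lagrange_mult _ _ _ _ Ubar) -hL -(subrK (diag_mx nu) Lbar) -/P mxtraceD.
apply: le_trans (lerD (stiefel_trace_le _ _ _ _ _ _ _ psdP hU UU) (lexx _)).
rewrite objective_diag mxtrace_diag -big_split /=; apply: ler_sum => i _.
(* The [i]-th domination is needed only on column [i] of [U], a unit vector, so the scalar matrix
   contributes exactly [nu 0 i]. *)
have := dom i; rewrite /loewner_le subr0 => /(psdmx_diag_ge0 _ _ _ _ U i).
rewrite mulmxBr mulmxDr mulmxBl mulmxDl mul_mx_scalar -scalemxAl.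
rewrite (UU : U^T *m U = 1%:M).
by rewrite 4!mxE [in X in _ + X]mxE mxE eqxx mulr1 subr_ge0.
Qed.
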